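(* Let $G$ be a torsion-free abelian group. If $G$ admits an automorphism $\alpha$ of odd order $n$ (possibly trivial) such that $C_G(\alpha)/C_G(\alpha)^2$ is finite, then $G$ is finitely integrable.
   Context: A group $A$ is finitely integrable if there exists a group $H$ such that $A\cong H'$ and $|H:H'|$ is finite, where $H'$ is the derived group (commutator subgroup) of $H$. Groups are written multiplicatively. $C_G(\alpha)=\{g\in G\mid \alpha(g)=g\}$, and for an abelian group $C$, $C^2=\{c^2\mid c\in C\}$. *)

(* Defs.v *)
From HB Require Import structures.
From mathcomp Require Import all_boot.
From mathcomp Require Import boolp classical_sets functions cardinality.

Set Implicit Arguments.
Unset Strict Implicit.
Unset Printing Implicit Defensive.

Local Open Scope classical_set_scope.
Local Open Scope group_scope.

(* Arbitrary (possibly infinite) groups are [groupType]s. The choice structure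
   a [groupType] carries is no restriction: classically every type has one. *)

Definition abelian_group (G : groupType) : Prop :=
  forall x y : G, commute x y.

Definition torsion_free (G : groupType) : Prop :=
  forall (x : G) (k : nat), (0 < k)%N -> x ^+ k = 1 -> x = 1.

Definition is_subgroup (G : groupType) (A : set G) : Prop :=
  [/\ A 1,
      forall x y : G, A x -> A y -> A (x * y)
    & forall x : G, A x -> A x^-1].

Definition derived_group (H : groupType) : set H :=
  smallest (@is_subgroup H) [set [~ xy.1, xy.2] | xy in [set: H * H]].

Arguments derived_group : clear implicits.

Definition left_cosets (G : groupType) (A B : set G) : set (set G) :=
  [set [set x * b | b in B] | x in A].

(* |A : B| is finite, for a subgroup B of A. When B is normal in A this says
   that the quotient group A / B is finite. *)
Definition finite_index (G : groupType) (A B : set G) : Prop :=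
  finite_set (left_cosets A B).

Definition finitely_integrable (A : groupType) : Prop :=
  exists H : groupType,
    (exists f : {multiplicative A -> H},
       set_bij [set: A] (derived_group H) f) /\
    finite_index [set: H] (derived_group H).

(* n is the least positive exponent with alpha ^ n = id. *)
Definition has_order (T : Type) (alpha : T -> T) (n : nat) : Prop :=
  [/\ (0 < n)%N,
      iter n alpha =1 id
    & forall m : nat, (0 < m)%N -> iter m alpha =1 id -> (n <= m)%N].

Definition fixed_subgroup (G : groupType) (alpha : G -> G) : set G :=
  [set g | alpha g = g].

Definition squares (G : groupType) (C : set G) : set G :=
  [set c ^+ 2 | c in C].

(* Main.v *)
Require Import Defs.
From HB Require Import structures.
From mathcomp Require Import all_boot.
From mathcomp Require Import ssralg zmodp.
From mathcomp Require Import boolp classical_sets functions cardinality.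

Set Implicit Arguments.
Unset Strict Implicit.
Unset Printing Implicit Defensive.

Local Open Scope classical_set_scope.
Local Open Scope group_scope.

(** Put [beta x = (alpha x)^-1], an automorphism of [G] since [G] is abelian.
As [n] is odd, [beta] has finite exponent [2n]; let [H] be the semidirect
product of [G] by a cyclic group of order [2n] acting through [beta]. Then
[H'] consists of the commutators of [G] with a generator of the cyclic factor,
that is, it is the image of [delta x = x^-1 * beta x], which is an endomorphism
of [G]. So [H] integrates [G] as soon as [delta] is injective with image of
finite index ([finitely_integrable_of_displacement]).

If [delta x = 1] then [alpha x = x^-1], and applying [alpha] an odd number of
times gives [x = x^-1]; torsion-freeness forces [x = 1]
([displacement_invert_eq1]).

Modulo the image [D] of [delta], [alpha] is inversion, because [x * alpha x] is
[delta x^-1]. Two consequences bound the index of [D]. The product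
[x * alpha x * alpha (alpha x) * ...] of odd length [n] is fixed by [alpha], and
modulo [D] its factors cancel in pairs and leave [x]; so the fixed subgroup [C]
surjects onto [G / D]. And for [c] in [C], [c ^+ 2 = c * alpha c] lies in [D].
Hence [G / D] is a quotient of the finite group [C / C^2]
([range_displacement_invert_finite_index]). *)

(** * Finite index through finite sets of representatives *)

(** The representatives need not lie in [A]: this is what allows the same set
to serve for the fixed subgroup and for the whole group. *)
Lemma finite_indexP (G : groupType) (A B : set G) : is_subgroup B ->
  finite_index A B <->
  exists2 S : set G, finite_set S &
    forall a, A a -> exists2 s, S s & B (s^-1 * a).
Proof.
move=> [B1 BM BV]; split=> [finAB|[S finS repS]].
  exists (xget 1 @` left_cosets A B); first exact: finite_image.
  move=> a Aa; pose X := [set a * b | b in B].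
  have [b Bb Eb] : X (xget 1 X).
    by apply: (xgetI _ (x := a)); exists 1; rewrite ?mulg1.
  exists (xget 1 X); first by exists X => //; exists a.
  by rewrite -Eb invgM mulgVK; apply: BV.
apply: sub_finite_set (finite_image (fun s => [set s * b | b in B]) finS).
move=> _ [a /repS[s Ss Bsa] <-]; exists s => //.
apply/seteqP; split=> _ [b Bb <-].
  exists ((s^-1 * a)^-1 * b); first by apply: BM => //; apply: BV.
  by rewrite invgM invgK -mulgA mulVKg.
exists (s^-1 * a * b); first exact: BM.
by rewrite -mulgA mulVKg.
Qed.

(** * The displacement of an endomorphism *)

Section Displacement.
Variables (G : groupType) (b : UMagmaMorphism.type G G).

Definition displacement (x : G) := x^-1 * b x.

Lemma iter_gmulfM k : {morph iter k b : x y / x * y}.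
Proof. by elim: k => // k IHk x y; rewrite !iterS IHk gmulfM. Qed.

Lemma iter_gmulfV k : {morph iter k b : x / x^-1}.
Proof. by elim: k => // k IHk x; rewrite !iterS IHk gmulfV. Qed.

Lemma iter_displacement k x :
  iter k b (displacement x) = displacement (iter k b x).
Proof. by rewrite iter_gmulfM iter_gmulfV /displacement -iterS iterSr. Qed.

Hypothesis hab : abelian_group G.

Lemma displacementM : {morph displacement : x y / x * y}.
Proof.
move=> x y; rewrite /displacement gmulfM invgM (hab y^-1).
by rewrite -!mulgA; congr (_ * _); rewrite !mulgA (hab y^-1).
Qed.

Lemma displacement1 : displacement 1 = 1.
Proof. by rewrite /displacement gmulf1 mulVg. Qed.

Lemma range_displacement_subgroup : is_subgroup (range displacement).
Proof.
split; first by exists 1; rewrite ?displacement1.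
  by move=> _ _ [x _ <-] [y _ <-]; exists (x * y); rewrite ?displacementM.
move=> _ [x _ <-]; exists x^-1 => //.
by apply/esym/mulg1_eq; rewrite -displacementM mulgV displacement1.
Qed.

Lemma displacement_inj :
  (forall x, displacement x = 1 -> x = 1) -> injective displacement.
Proof.
move=> ker1 x y Exy; apply/divg1_eq/ker1.
by rewrite displacementM Exy -displacementM mulgV displacement1.
Qed.

(** Iterates of [b] act trivially modulo the image of the displacement: the
quotient telescopes into displacements of successive iterates. *)
Lemma range_displacement_iter k x : range displacement (x^-1 * iter k b x).
Proof.
have [D1 DM _] := range_displacement_subgroup.
elim: k => [|k IHk] /=; first by rewrite mulVg.
rewrite -[b _](mulVKg (iter k b x)) mulgA; exact: DM.
Qed.

End Displacement.

(** * Semidirect product with a finite cyclic group *)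

Section CyclicExtension.
Variables (G : groupType) (b : UMagmaMorphism.type G G) (m : nat).
Hypothesis b_m : iter m.+1 b =1 id.

Lemma iter_modn k : iter (k %% m.+1) b =1 iter k b.
Proof.
move=> x; rewrite [in RHS](divn_eq k m.+1) addnC iterD.
suff -> : iter (k %/ m.+1 * m.+1) b x = x by [].
by elim: (k %/ m.+1) => // q IHq; rewrite mulSn iterD IHq b_m.
Qed.

Lemma iter_addI (i j : 'I_m.+1) x :
  iter (i + j)%R b x = iter i b (iter j b x).
Proof. by rewrite -iterD; exact: (iter_modn (i + j)). Qed.

(** The exponent [m.+1] of [b] makes [i |-> iter i b] an action of the additive
group ['I_m.+1]. The proof is an argument of the type so that the group
structure can be inferred from the type alone. *)
Definition cyclic_extension of iter m.+1 b =1 id := (G * 'I_m.+1)%type.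

Local Notation H := (cyclic_extension b_m).

HB.instance Definition _ := Choice.copy H (G * 'I_m.+1)%type.

Let mulH (x y : H) : H := (x.1 * iter x.2 b y.1, (x.2 + y.2)%R).
Let oneH : H := (1, 0%R).
Let invH (x : H) : H := (iter (- x.2)%R b x.1^-1, (- x.2)%R).

Let mulHA : associative mulH.
Proof.
move=> x y z; rewrite /mulH /=; congr (_, _); last by rewrite GRing.addrA.
by rewrite iter_gmulfM iter_addI mulgA.
Qed.

Let iter_gmulf1 k : iter k b 1 = 1.
Proof. by elim: k => //= k ->; rewrite gmulf1. Qed.

Let mul1H : left_id oneH mulH.
Proof. by case=> g i; rewrite /mulH /= mul1g GRing.add0r. Qed.

Let mulH1 : right_id oneH mulH.
Proof. by case=> g i; rewrite /mulH /= iter_gmulf1 mulg1 GRing.addr0. Qed.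

Let mulVH : left_inverse oneH invH mulH.
Proof.
case=> g i; rewrite /mulH /= -iter_gmulfM mulVg iter_gmulf1.
by rewrite GRing.addNr.
Qed.

Let mulHV : right_inverse oneH invH mulH.
Proof.
case=> g i; have := iter_addI i (- i)%R g^-1; rewrite GRing.addrN /mulH /= => <-.
by rewrite mulgV GRing.addrN.
Qed.

HB.instance Definition _ :=
  isGroup.Build H mulHA mul1H mulH1 mulVH mulHV.

Lemma cyclic_extensionM g h (i j : 'I_m.+1) :
  ((g, i) : H) * (h, j) = (g * iter i b h, (i + j)%R) :> H.
Proof. by []. Qed.

Lemma cyclic_extensionV g (i : 'I_m.+1) :
  ((g, i) : H)^-1 = (iter (- i)%R b g^-1, (- i)%R) :> H.
Proof. by []. Qed.

Hypothesis hab : abelian_group G.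

Definition base_displacement (x : G) : H := (displacement b x, 0%R).

Lemma base_displacementM : {morph base_displacement : x y / x * y}.
Proof.
by move=> x y; rewrite cyclic_extensionM /= GRing.add0r -displacementM.
Qed.

Lemma range_base_displacement_subgroup : is_subgroup (range base_displacement).
Proof.
have bd1 : base_displacement 1 = 1 by rewrite /base_displacement displacement1.
split; first by exists 1.
  by move=> _ _ [x _ <-] [y _ <-]; exists (x * y); rewrite ?base_displacementM.
move=> _ [x _ <-]; exists x^-1 => //.
by apply/esym/mulg1_eq; rewrite -base_displacementM mulgV.
Qed.

Lemma range_base_displacementP (x : H) :
  range (displacement b) x.1 -> x.2 = 0%R -> range base_displacement x.
Proof. by case: x => _ _ /= [y _ <-] ->; exists y. Qed.

(** Modulo the image of the displacement the action is trivial, so the first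
projection becomes multiplicative there. *)
Lemma fst_mul_congr (x y : H) :
  exists2 d, range (displacement b) d & (x * y).1 = x.1 * y.1 * d.
Proof.
exists (y.1^-1 * iter x.2 b y.1); first exact: range_displacement_iter.
by rewrite -!mulgA mulVKg.
Qed.

(** The first projection modulo the image of the displacement and the second
projection are both morphisms to abelian groups, so they kill commutators;
conversely every displacement is a commutator of an element of [G] with a
generator of the cyclic factor. *)
Lemma derived_cyclic_extension : derived_group H = range base_displacement.
Proof.
have [D1 DM DV] := range_displacement_subgroup b hab.
apply/seteqP; split.
  apply: smallest_sub; first exact: range_base_displacement_subgroup.
  move=> _ [[x y] _ <-] /=; set z := [~ x, y].
  apply: range_base_displacementP; last first.
    have : (x.2 + y.2 = y.2 + x.2 + z.2)%R := congr1 snd (commgC x y).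
    by rewrite (GRing.addrC y.2) -[LHS]GRing.addr0 => /GRing.addrI.
  have [d1 D_d1 E1] := fst_mul_congr x y.
  have [d2 D_d2 E2] := fst_mul_congr y x.
  have [d3 D_d3 E3] := fst_mul_congr (y * x) z.
  have : x.1 * y.1 * d1 = x.1 * y.1 * (d2 * z.1 * d3).
    by rewrite -E1 (commgC x y) -/z E3 E2 (hab y.1) !mulgA.
  move=> /mulgI E; rewrite -[z.1](mulKg d2) -[d2 * _](mulgK d3) -E.
  exact: DM _ _ (DV _ D_d2) (DM _ _ D_d1 (DV _ D_d3)).
apply: sub_smallest => _ [x _ <-].
(* Only the action of [t] matters: it is also a generator when [m = 0], where
   the cyclic group is trivial and [b] is the identity. *)
have [t iter_t] : exists t : 'I_m.+1, iter t b =1 b.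
  by exists Zp1 => g; rewrite [LHS]iter_modn.
exists ((x, 0%R) : H, (1, (- t)%R) : H) => //=.
rewrite /commg /conjg !(cyclic_extensionM, cyclic_extensionV).
rewrite invg1 !iter_gmulf1 mul1g mulg1.
by rewrite GRing.oppr0 !GRing.add0r GRing.opprK GRing.addrN iter_t.
Qed.

Lemma finite_index_derived_cyclic_extension :
  finite_index [set: G] (range (displacement b)) ->
  finite_index [set: H] (derived_group H).
Proof.
rewrite derived_cyclic_extension.
move/(finite_indexP _ (range_displacement_subgroup b hab)) => [S finS repS].
apply/(finite_indexP _ range_base_displacement_subgroup).
exists [set x : H | S x.1]; last first.
  case=> g i _; have [s Ss [d _ Ed]] := repS g I.
  exists ((s, i) : H) => //; apply: range_base_displacementP.
    rewrite cyclic_extensionV cyclic_extensionM /= -iter_gmulfM -Ed.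
    by rewrite iter_displacement; eexists.
  by rewrite cyclic_extensionV cyclic_extensionM /= GRing.addNr.
have : finite_set (S `*` [set: 'I_m.+1]).
  by apply: finite_setX => //; exact: finite_finset.
by apply: sub_finite_set => x.
Qed.

End CyclicExtension.

(** The displacement is then an isomorphism of [G] onto its image, which is the
derived group of the cyclic extension. *)
Theorem finitely_integrable_of_displacement (G : groupType)
    (b : UMagmaMorphism.type G G) (m : nat) :
  abelian_group G -> (0 < m)%N -> iter m b =1 id ->
  injective (displacement b) ->
  finite_index [set: G] (range (displacement b)) ->
  finitely_integrable G.
Proof.
case: m => // m hab _ b_m inj_b fin_b; exists (cyclic_extension b_m).
split; last exact: finite_index_derived_cyclic_extension.
pose f := base_displacement b_m.
pose fM := isMultiplicative.Build G _ f (base_displacementM b_m hab).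
exists (HB.pack f fM : {multiplicative G -> cyclic_extension b_m}).
rewrite derived_cyclic_extension //; split=> //.
by move=> x y _ _ [Exy]; apply: inj_b.
Qed.

(** * Composing an automorphism with inversion *)

Section InvertedAutomorphism.
Variables (G : groupType) (hab : abelian_group G).
Variable alpha : {multiplicative G -> G}.

(** Commutativity is an argument because it is what makes this map a morphism,
a structure that is inferred from the function itself. *)
Definition invert_morphism of abelian_group G := fun x : G => (alpha x)^-1.

Local Notation beta := (invert_morphism hab).

Let alpha1 : alpha 1 = 1.
Proof. by apply: (@mulgI _ (alpha 1)); rewrite -gmulfM !mulg1. Qed.

Let alphaV : {morph alpha : x / x^-1}.
Proof. by move=> x; apply/esym/mulg1_eq; rewrite -gmulfM mulgV. Qed.

Let betaF : {morph beta : x y / x / y}.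
Proof. by move=> x y; rewrite /invert_morphism gmulfM alphaV invgM hab. Qed.

HB.instance Definition _ := isGroupMorphism.Build G G beta betaF.

Lemma iter_invert_double k x : iter k.*2 beta x = iter k.*2 alpha x.
Proof.
elim: k => // k IHk; rewrite doubleS !iterS IHk.
by rewrite gmulfV /invert_morphism invgK.
Qed.

(** This is how both the squares of fixed points and the adjacent pairs in an
orbit product are recognised as displacements. *)
Lemma displacement_invertV x : displacement beta x^-1 = x * alpha x.
Proof. by rewrite /displacement gmulfV /invert_morphism !invgK. Qed.

(** A fixed point of [beta] is fixed by the even iterates of [alpha], which are
those of [beta]; one more application of [alpha] gives both [x] and [x^-1]. *)
Lemma displacement_invert_eq1 k x :
    torsion_free G -> iter k.*2.+1 alpha =1 id ->
  displacement beta x = 1 -> x = 1.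
Proof.
move=> htf alpha_k dx1.
have bx : beta x = x.
  by apply: (@mulgI _ x^-1); rewrite mulVg.
have iter_bx j : iter j beta x = x by elim: j => // j IHj; rewrite iterS IHj.
have x2 : x = x^-1.
  by rewrite -[LHS]alpha_k iterS -iter_invert_double iter_bx -[in RHS]bx invgK.
by apply: (htf x 2) => //; rewrite expg2 {1}x2 mulVg.
Qed.

Definition orbit_product k (x : G) := \prod_(i < k) iter i alpha x.

Lemma orbit_product_fixed k x :
  iter k alpha x = x -> fixed_subgroup alpha (orbit_product k x).
Proof.
move=> alpha_k; rewrite /fixed_subgroup /= /orbit_product.
rewrite (big_morph _ (@gmulfM _ _ alpha) alpha1); apply: (@mulgI _ x).
have := @big_ord_recl _ 1 *%g k (fun i : 'I_k.+1 => iter i alpha x).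
by rewrite big_ord_recr /= alpha_k => <-; rewrite hab.
Qed.

(** After the first factor [x], the remaining factors group into pairs
[y * alpha y], which are displacements. *)
Lemma orbit_product_congr k x :
  range (displacement beta) (x^-1 * orbit_product k.*2.+1 x).
Proof.
have [D1 DM _] := range_displacement_subgroup beta hab.
elim: k => [|k IHk]; first by rewrite /orbit_product big_ord1 mulVg.
set y := iter k.*2.+1 alpha x.
have -> : orbit_product k.+1.*2.+1 x = orbit_product k.*2.+1 x * (y * alpha y).
  by rewrite mulgA {1}/orbit_product doubleS 2!big_ord_recr.
by rewrite mulgA; apply: DM => //; exists y^-1; rewrite ?displacement_invertV.
Qed.

(** Representatives modulo the squares of the fixed subgroup, applied to the
orbit product of [x], also represent [x] modulo displacements. *)
Lemma range_displacement_invert_finite_index k :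
  iter k.*2.+1 alpha =1 id ->
  finite_index (fixed_subgroup alpha) (squares (fixed_subgroup alpha)) ->
  finite_index [set: G] (range (displacement beta)).
Proof.
move=> alpha_k.
have D_subgroup := range_displacement_subgroup beta hab.
have squares_subgroup : is_subgroup (squares (fixed_subgroup alpha)).
  split; first by exists 1; [exact: alpha1 | exact: expg1n].
    move=> _ _ [x Cx <-] [y Cy <-]; exists (x * y); last exact: expgMn.
    by rewrite /fixed_subgroup /= gmulfM Cx Cy.
  move=> _ [x Cx <-]; exists x^-1; last exact: expVgn.
  by rewrite /fixed_subgroup /= alphaV Cx.
move/(finite_indexP _ squares_subgroup) => [S finS repS].
apply/(finite_indexP _ D_subgroup); exists S => // x _.
have [s Ss [c Cc Ec]] := repS _ (orbit_product_fixed (alpha_k x)).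
exists s => //; have [_ DM DV] := D_subgroup.
have -> : s^-1 * x = c ^+ 2 * (x^-1 * orbit_product k.*2.+1 x)^-1.
  by rewrite Ec invgM invgK -mulgA mulVKg.
apply: DM; last exact/DV/orbit_product_congr.
by exists c^-1; rewrite // displacement_invertV Cc expg2.
Qed.

End InvertedAutomorphism.

Theorem theorem5p14 (G : groupType)
    (hab : abelian_group G) (htf : torsion_free G)
    (alpha : {multiplicative G -> G}) (n : nat)
    (halpha : bijective alpha)
    (hord : has_order alpha n) (hodd : odd n)
    (hfin : finite_index (fixed_subgroup alpha)
                         (squares (fixed_subgroup alpha))) :
  finitely_integrable G.
Proof.
have [n_gt0 alpha_n _] := hord.
have n_eq : n = n./2.*2.+1 by rewrite -[LHS]odd_double_half hodd.
rewrite n_eq in alpha_n.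
pose beta : UMagmaMorphism.type G G := invert_morphism alpha hab.
apply: (@finitely_integrable_of_displacement _ beta n.*2) => //.
- by rewrite double_gt0.
- move=> x; rewrite iter_invert_double -addnn iterD n_eq.
  by rewrite !alpha_n.
- apply: displacement_inj => // x; exact: displacement_invert_eq1 alpha_n.
- exact: range_displacement_invert_finite_index alpha_n hfin.
Qed.
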